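(* Suppose there is $a\in\{0,1\}$, with $\neg a=1-a$, such that both of the following hold: (1) $E\{Z_i\mid A_i=a\}<E\{Z_i\mid A_i=\neg a\}$; (2) $E\{R_i\mid A_i=a\}>E\{R_i\mid A_i=\neg a\}$. Then there exists $\epsilon_o>0$ such that $\hat\gamma(\epsilon_o)=0$ under $\mathscr{A}_{\epsilon_o}$, i.e. $\mathscr{A}_{\epsilon_o}$ is perfectly fair in the demographic parity sense.
   Context: There are $n$ individuals indexed by $\mathcal{N}=\{1,\dots,n\}$. Individual $i$ is described by a random tuple $(X_i,A_i,Y_i)$, with features $X_i\in\mathcal{X}$, protected attribute $A_i\in\{0,1\}$ and qualification state $Y_i\in\{0,1\}$; the tuples are i.i.d. with a common distribution $\mathsf{F}$. A fixed function $r:\mathcal{X}\to\mathcal{R}$ is given, with $\mathcal{R}\subset[0,1]$ finite, and $R_i=r(X_i)$. Both events $\{A_i=0\}$, $\{A_i=1\}$ are assumed to have positive probability. For $\epsilon\ge0$, the exponential mechanism $\mathscr{A}_\epsilon$ selects individual $i$ with probability $Z_{i,\epsilon}=\exp(\epsilon R_i/2)/\sum_{j=1}^n\exp(\epsilon R_j/2)$ given the scores, and the demographic parity gap is $\hat\gamma(\epsilon)=E\{Z_{i,\epsilon}\mid A_i=0\}-E\{Z_{i,\epsilon}\mid A_i=1\}$. With $N_{\max}=|\{i:R_i=\max_jR_j\}|$, let $Z_i=0$ if $R_i\ne\max_jR_j$ and $Z_i=1/N_{\max}$ otherwise. *)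

(* Defs.v *)
From HB Require Import structures.
From mathcomp Require Import all_boot all_order all_algebra.
From mathcomp Require Import all_classical all_reals all_analysis.
Set Implicit Arguments. Unset Strict Implicit. Unset Printing Implicit Defensive.
Import Order.TTheory GRing.Theory Num.Theory.
Local Open Scope classical_set_scope.
Local Open Scope ring_scope.

Definition iid (R : realType) (d : measure_display) (Omega : measurableType d)
  (P : probability Omega R) (dT : measure_display) (T : measurableType dT)
  (n : nat) (V : 'I_n -> Omega -> T) : Prop :=
  [/\ (forall i, measurable_fun setT (V i)),
      (forall B : 'I_n -> set T, (forall i, measurable (B i)) ->
         P (\bigcap_(i in setT) (V i @^-1` B i)) =
         (\prod_(i < n) P (V i @^-1` B i))%E) &
      (forall (i j : 'I_n) (B : set T), measurable B ->
         P (V i @^-1` B) = P (V j @^-1` B))].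

Definition condE (R : realType) (d : measure_display) (Omega : measurableType d)
  (P : probability Omega R) (W : Omega -> R) (E : set Omega) : R :=
  fine (\int[P]_(w in E) (W w)%:E) / fine (P E).

(* Exponential mechanism selection probability Z_{i,eps}. *)
Definition Zeps (R : realType) (Omega : Type) (n : nat)
  (Rs : 'I_n -> Omega -> R) (eps : R) (i : 'I_n) (w : Omega) : R :=
  expR (eps * Rs i w / 2) / \sum_(j < n) expR (eps * Rs j w / 2).

(* Limiting (eps -> oo) selection probability Z_i: uniform among maximizers. *)
Definition is_max (R : realType) (Omega : Type) (n : nat)
  (Rs : 'I_n -> Omega -> R) (w : Omega) (i : 'I_n) : bool :=
  [forall k : 'I_n, Rs k w <= Rs i w].

Definition Zlim (R : realType) (Omega : Type) (n : nat)
  (Rs : 'I_n -> Omega -> R) (i : 'I_n) (w : Omega) : R :=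
  if is_max Rs w i then (#|[set j : 'I_n | is_max Rs w j]|%:R)^-1 else 0.

Definition dp_gap (R : realType) (d : measure_display) (Omega : measurableType d)
  (P : probability Omega R) (n : nat) (Rs : 'I_n -> Omega -> R)
  (As : 'I_n -> Omega -> bool) (i : 'I_n) (eps : R) : R :=
  condE P (Zeps Rs eps i) [set w | As i w = false]
  - condE P (Zeps Rs eps i) [set w | As i w = true].

(* Main.v *)
(** Let g(eps) be the gap E{Z_eps | A = a} - E{Z_eps | A = ~a}, so that
    g(0) = 0. Because the tuples are independent, E{R_j | A_i} does not depend
    on A_i for j <> i, and hence g'(0) = (1 - 1/n) / (2n) times the gap of the
    mean scores of i, which is positive by (2); the case n = 1 is excluded by
    (1). As eps -> oo, g(eps) tends to the gap of the limiting probabilities,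
    which is negative by (1). So g, which is continuous, changes sign on
    (0, oo). The scores take finitely many values, so g is a finite linear
    combination, with signed weights summing to 0, of explicit functions of
    eps. *)
Require Import Defs.
From HB Require Import structures.
From mathcomp Require Import all_boot all_order all_algebra.
From mathcomp Require Import all_classical all_reals all_analysis.
From mathcomp Require Import measurable_realfun ring lra.
Import Order.TTheory GRing.Theory Num.Theory.
Import numFieldNormedType.Exports.
Local Open Scope classical_set_scope.
Local Open Scope ring_scope.

(** * The mechanism at a fixed score profile: behaviour near 0 and at infinity *)

Section FiniteScores.
Context {R : realType} {n : nat}.

Lemma cvg_sumr {T I : Type} {F : set_system T} {FF : Filter F} (s : seq I)
    (f : I -> T -> R) (l : I -> R) :
  (forall k, f k x @[x --> F] --> l k) ->
  (\sum_(k <- s) f k x) @[x --> F] --> \sum_(k <- s) l k.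
Proof. by move=> fl; apply: cvg_big => [|k _]; [exact: add_continuous|exact: fl]. Qed.

(** This is the derivative of [expR (x * c)] at 0, from the chain rule, unfolded into a limit over
    punctured neighbourhoods. *)
Lemma expR_quotient_cvg (c : R) :
  x^-1 * (expR (x * c) - 1) @[x --> 0^'] --> c.
Proof.
have D : is_derive (0 : R) 1 (expR \o *%R^~ c) (1 * c).
  have D0 : is_derive (0 * c : R) 1 (@expR R) 1.
    by rewrite mul0r -[X in is_derive _ _ _ X](expR0 R); exact: is_derive_expR.
  apply: is_derive1_comp.
  have -> : *%R^~ c = c \*: (@id R) by apply/funext => x; rewrite /= mulrC.
  by apply: is_derive_eq; rewrite /GRing.scale /= mulr1.
have [D1 D2] := D; rewrite mul1r in D2.
move: D1; rewrite /derivable => /cvg_ex[l Dl].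
have lc : l = c by rewrite -D2 /derive; apply/esym/cvg_lim.
move: Dl; rewrite lc; apply: cvg_trans; apply: near_eq_cvg.
near=> x; rewrite /= /GRing.scale /= mulr1 addr0 mul0r expR0 //.
Unshelve. all: by end_near. Qed.

Context {T : Type} (v : 'I_n -> T -> R) (i : 'I_n).

Lemma Zeps_den_gt0 x t : 0 < \sum_(j < n) expR (x * v j t / 2).
Proof.
rewrite (bigD1 i)//= ltr_pwDl ?expR_gt0//.
by apply: sumr_ge0 => j _; exact: expR_ge0.
Qed.

Lemma Zeps_ge0 x t : 0 <= Zeps v x i t.
Proof. by rewrite divr_ge0 ?expR_ge0 ?ltW ?Zeps_den_gt0. Qed.

Lemma Zlim_ge0 t : 0 <= Zlim v i t.
Proof. by rewrite /Zlim; case: ifP => // _; rewrite invr_ge0. Qed.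

Lemma continuous_expRM (c : R) : continuous (fun x : R => expR (x * c / 2)).
Proof.
move=> x; apply: (@continuous_comp _ _ _ (fun x : R => x * c / 2) expR).
  by apply: cvgMl; apply: cvgMl; exact: cvg_id.
exact: continuous_expR.
Qed.

Lemma continuous_Zeps t : continuous (fun x => Zeps v x i t).
Proof.
move=> x; apply: cvgM; first exact: continuous_expRM.
apply: cvgV; first by rewrite gt_eqF// Zeps_den_gt0.
by apply: cvg_sumr => j; exact: continuous_expRM.
Qed.

Lemma Zeps0 t : Zeps v 0 i t = n%:R^-1.
Proof.
rewrite /Zeps !mul0r expR0 div1r; congr (_^-1).
by rewrite (eq_bigr (fun=> 1)) ?sumr_const ?card_ord// => j _; rewrite !mul0r expR0.
Qed.

Lemma ord_neq0 : n%:R != 0 :> R.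
Proof. by rewrite pnatr_eq0 -lt0n (leq_ltn_trans _ (ltn_ord i)). Qed.

(** Since [Zeps] equals 1/n at 0, this is its derivative there. *)
Lemma Zeps_quotient_cvg t :
  x^-1 * (Zeps v x i t - n%:R^-1) @[x --> 0^'] -->
    (v i t / 2 - n%:R^-1 * \sum_(j < n) v j t / 2) / n%:R.
Proof.
(* With S the denominator and e_i the numerator, Z - 1/n = (e_i - S/n) / S. Subtracting 1 from every
   exponential leaves e_i - S/n unchanged, so only difference quotients of exponentials remain. *)
have H : ((x^-1 * (expR (x * (v i t / 2)) - 1)
          - n%:R^-1 * \sum_(j < n) x^-1 * (expR (x * (v j t / 2)) - 1))
          / \sum_(j < n) expR (x * v j t / 2)) @[x --> 0^'] -->
      (v i t / 2 - n%:R^-1 * \sum_(j < n) v j t / 2) / n%:R.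
  apply: cvgM.
    apply: cvgB; first exact: expR_quotient_cvg.
    by apply: cvgMr; apply: cvg_sumr => j; exact: expR_quotient_cvg.
  apply: cvgV; first exact: ord_neq0.
  have -> : n%:R = \sum_(j < n) expR (0 * v j t / 2).
    rewrite (eq_bigr (fun=> 1)) ?sumr_const ?card_ord// => j _.
    by rewrite !mul0r expR0.
  apply: cvg_sumr => j; apply: cvg_within_filter; exact: continuous_expRM.
move: H; apply: cvg_trans; apply: near_eq_cvg; near=> x.
rewrite /Zeps -mulr_sumr big_split/= sumrN sumr_const card_ord.
under eq_bigr do rewrite mulrA.
rewrite [x * (v i t / 2)]mulrA.
have := Zeps_den_gt0 x t; have := ord_neq0.
move: (\sum_(j < n) _) => S nN0 /gt_eqF/negbT S0.
have x0 : x != 0 by near: x; exact: nbhs_dnbhs_neq.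
by field; rewrite ?S0 ?x0 ?nN0.
Unshelve. all: by end_near. Qed.

Lemma expRM_cvgy0 (c : R) : c < 0 -> expR (x * c / 2) @[x --> +oo] --> 0.
Proof.
move=> c0.
have -> : (fun x : R => expR (x * c / 2)) =
    (fun y => expR (- y)) \o (fun x => x * (- c / 2)).
  by apply/funext => x /=; congr expR; ring.
apply: cvg_comp (@cvgr_expR R).
by apply: gt0_cvgMly; [lra|exact: cvg_id].
Qed.

(** Dividing through by the numerator makes Z the inverse of a sum of
    [expR (x * (v j t - v i t) / 2)]: ties with i contribute 1, lower scores vanish, and one higher
    score makes the sum blow up. *)
Lemma Zeps_cvgy t : Zeps v x i t @[x --> +oo] --> Zlim v i t.
Proof.
have E x : Zeps v x i t = (\sum_(j < n) expR (x * (v j t - v i t) / 2))^-1.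
  rewrite /Zeps -[LHS]invf_div; congr (_^-1).
  rewrite mulr_suml; apply: eq_bigr => j _.
  by rewrite -expRN -expRD; congr expR; ring.
rewrite /Zlim; case: ifPn => [/forallP imax|].
  under eq_fun do rewrite E.
  have isE j : (j \in [set k | is_max v t k]) = (v j t == v i t).
    apply/idP/eqP => [|jE]; rewrite inE/= /is_max.
      by move=> /forallP jmax; apply/eqP; rewrite eq_le imax jmax.
    by apply/forallP => k; rewrite jE.
  have cardE : #|[set j | is_max v t j]|%:R = \sum_(j < n) (v j t == v i t)%:R :> R.
    rewrite -sum1_card natr_sum big_mkcond/=; apply: eq_bigr => j _.
    by rewrite isE; case: eqP.
  rewrite cardE; apply: cvgV.
    rewrite -cardE pnatr_eq0 -lt0n; apply/card_gt0P; exists i.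
    by rewrite isE.
  apply: cvg_sumr => j; case: eqP => [->|/eqP ji].
    by under eq_fun do rewrite subrr mulr0 mul0r expR0; exact: cvg_cst.
  by apply: expRM_cvgy0; rewrite subr_lt0 lt_neqAle ji imax.
rewrite negb_forall => /existsP[k]; rewrite -ltNge => ik.
(* The upper bound keeps only the term of the better individual k in the sum. *)
apply: (@squeeze_cvgr _ _ _ _ (fun=> 0) (fun x => expR (x * (v i t - v k t) / 2))).
- near=> x; rewrite Zeps_ge0/= E.
  rewrite -[leRHS]invrK lef_pV2 ?posrE ?invr_gt0 ?expR_gt0//; last first.
    by rewrite -[X in 0 < X]invrK -E invr_gt0 divr_gt0 ?expR_gt0// Zeps_den_gt0.
  rewrite -expRN (bigD1 k)//= (_ : - _ = x * (v k t - v i t) / 2); last by ring.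
  by rewrite lerDl sumr_ge0// => j _; exact: expR_ge0.
- exact: cvg_cst.
- by apply: expRM_cvgy0; rewrite subr_lt0.
Unshelve. all: by end_near. Qed.

End FiniteScores.


(** * Sign change of a signed average of selection probabilities *)

Section Crossing.
Context {R : realType} {n : nat} {K : finType} (v : 'I_n -> K -> R) (i : 'I_n).
(** [q] stands for the difference of the two conditional laws of the score vector. Then [q0] says
    that both have mass 1, [qj] expresses independence of the other scores from the attribute of i,
    and [qi] and [qlim] are conditions (2) and (1). *)
Variable q : K -> R.
Hypothesis q0 : \sum_k q k = 0.
Hypothesis qj : forall j, j != i -> \sum_k q k * v j k = 0.
Hypothesis qi : 0 < \sum_k q k * v i k.
Hypothesis qlim : \sum_k q k * Zlim v i k < 0.

Let G x := \sum_k q k * Zeps v x i k.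

(** A lone individual is always selected, so the average in [qlim] would be the total mass of [q],
    which is 0. *)
Lemma crossing_n_gt1 : (1 < n)%N.
Proof.
rewrite ltn_neqAle (leq_ltn_trans _ (ltn_ord i))// andbT.
apply: contraTneq qlim => n1; rewrite -leNgt.
suff E k : Zlim v i k = 1.
  by under eq_bigr do rewrite E mulr1; rewrite q0.
have ai j : j = i.
  have ord0n (m : 'I_n) : m = 0%N :> nat.
    by apply/eqP; rewrite -leqn0 -ltnS n1.
  by apply/val_inj; rewrite /= !ord0n.
have im j : is_max v k j by apply/forallP => l; rewrite (ai l) (ai j).
have cE : #|[set j : 'I_n | is_max v k j]| = #|'I_n|.
  by apply: eq_card => j; rewrite !inE; apply/asboolP; exact: im.
by rewrite /Zlim im cE card_ord -n1 invr1.
Qed.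

Lemma Zeps_average_crossing : exists eps, 0 < eps /\ G eps = 0.
Proof.
have n1 := crossing_n_gt1.
have n0 : 0 < n%:R :> R by rewrite ltr0n ltnW.
have Gc : continuous G.
  move=> x; apply: cvg_sumr => k; apply: cvgMr; exact: continuous_Zeps.
have Gy : G x @[x --> +oo] --> \sum_k q k * Zlim v i k.
  by apply: cvg_sumr => k; apply: cvgMr; exact: Zeps_cvgy.
have [h h0 Gh] : exists2 h, 0 < h & 0 < G h.
  have : x^-1 * G x @[x --> 0^'] -->
      \sum_k q k * ((v i k / 2 - n%:R^-1 * \sum_(j < n) v j k / 2) / n%:R).
    (* Subtracting the constant 1/n is free because [q] sums to 0. *)
    have -> : (fun x => x^-1 * G x) =
        (fun x => \sum_k q k * (x^-1 * (Zeps v x i k - n%:R^-1))).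
      apply/funext => x; rewrite /G.
      under [RHS]eq_bigr do rewrite mulrCA mulrBr.
      by rewrite -mulr_sumr sumrB -mulr_suml q0 mul0r subr0.
    by apply: cvg_sumr => k; apply: cvgMr; exact: Zeps_quotient_cvg.
  have -> : \sum_k q k * ((v i k / 2 - n%:R^-1 * \sum_(j < n) v j k / 2) / n%:R)
      = (\sum_k q k * v i k) * ((1 - n%:R^-1) / 2 / n%:R).
    transitivity ((\sum_k q k * v i k - n%:R^-1 * \sum_(j < n) \sum_k q k * v j k) / 2 / n%:R).
      rewrite exchange_big mulr_sumr -sumrB !mulr_suml; apply: eq_bigr => k _.
      by rewrite -mulr_suml -mulr_sumr; field; rewrite gt_eqF.
    (* By [qj] only the term j = i survives, which produces the factor 1 - 1/n. *)
    rewrite (_ : \sum_(j < n) _ = \sum_k q k * v i k); first by ring.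
    by rewrite (bigD1 i)//= [X in _ + X]big1 ?addr0.
  move=> /cvg_dnbhs_at_right /cvgr_gt /(_ 0) H.
  have {H} : \forall t \near 0^'+, 0 < t^-1 * G t.
    apply: H; rewrite mulr_gt0// divr_gt0// divr_gt0// subr_gt0 invf_lt1//.
    by rewrite ltr1n.
  move=> H; have [h [h0]] := filter_ex (filterI (nbhs_right_gt 0) H).
  by rewrite pmulr_rgt0 ?invr_gt0// => Gh; exists h.
have [M hM GM] : exists2 M, h < M & G M < 0.
  by apply: pinfty_ex_gt; [exact: num_real|exact: (cvgr_lt _ Gy)].
(* Starting the interval at h rather than at the trivial zero 0 forces the root to be positive. *)
have [||c] := @IVT R G h M 0 (ltW hM).
- exact: continuous_subspaceT.
- by rewrite ge_min (ltW GM) orbT le_max (ltW Gh).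
rewrite in_itv/= => /andP[hc _] Gc0; exists c; split=> //; exact: lt_le_trans hc.
Qed.

End Crossing.

(** * Conditional expectations of functions of a finitely valued variable *)

Section FiniteRange.
Context {R : realType} {d : measure_display} {Omega : measurableType d}
  (P : probability Omega R) {K : finType} (V : Omega -> K).
Hypothesis mV : forall k, measurable (V @^-1` [set k]).

Definition condP (E : set Omega) (k : K) : R :=
  fine (P (E `&` V @^-1` [set k])) / fine (P E).

Lemma integral_finite_range (h : K -> R) (E : set Omega) :
  measurable E -> (forall k, 0 <= h k) ->
  (\int[P]_(w in E) (h (V w))%:E =
   \sum_k (h k)%:E * P (E `&` V @^-1` [set k]))%E.
Proof.
move=> mE h0.
(* h(V) is a combination of indicators of the fibres of V; nonnegativity allows exchanging sum and
   integral without an integrability argument. *)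
transitivity (\int[P]_(w in E) \sum_k ((h k)%:E * (\1_(V @^-1` [set k]) w)%:E))%E.
  apply: eq_integral => w _; rewrite (bigD1 (V w))//= big1 ?adde0.
    by rewrite indicE mem_set// mule1.
  by move=> k kV; rewrite indicE memNset ?mule0// => /esym/eqP; rewrite (negbTE kV).
rewrite ge0_integral_sum//; last 2 first.
- move=> k; apply/measurable_EFinP; apply: measurable_funM; first exact: measurable_cst.
  exact: measurable_indic.
- by move=> k w _; rewrite mule_ge0// lee_fin.
apply: eq_bigr => k _; rewrite ge0_integralZl_EFin//.
- by rewrite integral_indic// setIC.
- by apply/measurable_EFinP; exact: measurable_indic.
Qed.

Lemma condE_finite_range (h : K -> R) (E : set Omega) :
  measurable E -> (forall k, 0 <= h k) ->
  condE P (fun w => h (V w)) E = \sum_k condP E k * h k.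
Proof.
move=> mE h0; rewrite /condE integral_finite_range//.
under eq_bigr => k _.
  rewrite -[P _]fineK; last by apply: fin_num_measure; apply: measurableI => //; exact: mV.
  by rewrite -EFinM; over.
rewrite sumEFin/= mulr_suml; apply: eq_bigr => k _.
by rewrite /condP; ring.
Qed.

Lemma sum_condP (E : set Omega) :
  measurable E -> (0 < P E)%E -> \sum_k condP E k = 1.
Proof.
move=> mE PE.
transitivity (condE P (fun=> 1) E).
  by rewrite (condE_finite_range (fun=> 1))//; apply: eq_bigr => k _; rewrite mulr1.
rewrite /condE integral_cst// mul1e divff// gt_eqF// fine_gt0// PE/=.
by rewrite -ge0_fin_numE// fin_num_measure.
Qed.

End FiniteRange.

(** Joint independence is applied with the whole space as the event of every index other than i and
    j. *)
Lemma iid_pairwise {R : realType} {d : measure_display} {Omega : measurableType d}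
    {P : probability Omega R} {dT : measure_display} {T : measurableType dT}
    {n : nat} {U : 'I_n -> Omega -> T} {i j : 'I_n} {A B : set T} :
  iid P U -> j != i -> measurable A -> measurable B ->
  P (U i @^-1` A `&` U j @^-1` B) = (P (U i @^-1` A) * P (U j @^-1` B))%E.
Proof.
move=> [_ indep _] ji mA mB.
pose C k := if k == i then A else if k == j then B else setT.
have mC k : measurable (C k) by rewrite /C; case: ifP => // _; case: ifP.
have := indep C mC.
rewrite (bigD1 i)//= (bigD1 j)//= big1; last first.
  by move=> k /andP[/negbTE ki /negbTE kj]; rewrite /C ki kj preimage_setT probability_setT.
rewrite mule1 {2 3}/C eqxx (negbTE ji) eqxx => <-; congr (P _).
apply/seteqP; split => [w [wA wB] k _|w wC]; rewrite /C/=.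
  by case: eqP => [->//|_]; case: eqP => [->|].
by split; [have := wC i I|have := wC j I]; rewrite /C/= ?eqxx// (negbTE ji).
Qed.

(** * From random tuples to signed weights on finite score vectors *)

Theorem theorem7 (R : realType) (d : measure_display) (Omega : measurableType d)
  (P : probability Omega R)
  (dX : measure_display) (X : measurableType dX)
  (n : nat) (Xs : 'I_n -> Omega -> X) (As : 'I_n -> Omega -> bool)
  (Ys : 'I_n -> Omega -> bool)
  (r : X -> R)
  (Hiid : iid P (fun i w => (Xs i w, As i w, Ys i w)))
  (Hrm : measurable_fun setT r)
  (Hrfin : finite_set (range r))
  (Hr01 : forall x, 0 <= r x <= 1)
  (HA0 : forall i, (0 < P [set w | As i w = false])%E)
  (HA1 : forall i, (0 < P [set w | As i w = true])%E)
  (i : 'I_n) (a : bool) :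
  let Rs := fun j w => r (Xs j w) in
  condE P (Zlim Rs i) [set w | As i w = a]
    < condE P (Zlim Rs i) [set w | As i w = ~~ a] ->
  condE P (Rs i) [set w | As i w = a]
    > condE P (Rs i) [set w | As i w = ~~ a] ->
  exists eps0 : R, 0 < eps0 /\ dp_gap P Rs As i eps0 = 0.
Proof.
move=> Rs Hlim Hmean.
pose U j w := (Xs j w, As j w, Ys j w).
pose E b := [set w | As i w = b].
have PE b : (0 < P (E b))%E by case: b; [exact: HA1|exact: HA0].
have mU j : measurable_fun setT (U j) by case: Hiid => mXAY _ _; exact: mXAY.
have EU b : E b = U i @^-1` (setT `*` [set b] `*` setT).
  by apply/seteqP; split => w //= -[[]].
have mEU b : measurable ((setT `*` [set b] `*` setT) : set (X * bool * bool)).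
  by apply: measurableX => //; exact: measurableX.
have mE b : measurable (E b) by rewrite EU -[X in measurable X]setTI; exact: mU.
(* Events on scores and attributes are written as preimages under the tuples, the form in which
   measurability and independence are given. *)
pose D y : set (X * bool * bool) := (r @^-1` [set y] `*` setT) `*` setT.
have mD y : measurable (D y).
  apply: measurableX => //; apply: measurableX => //.
  by rewrite -[X in measurable X]setTI; exact: Hrm.
have DU j y : Rs j @^-1` [set y] = U j @^-1` D y.
  by apply/seteqP; split => w //= -[[]].
have mRs j y : measurable (Rs j @^-1` [set y]).
  by rewrite DU -[X in measurable X]setTI; exact: mU.
have [s rs] := (finite_seqP _).1 Hrfin.
have sr j w : Rs j w \in s.
  by have : range r (Rs j w) by [exists (Xs j w)]; rewrite rs.
have r_ge0 (y : seq_sub s) : 0 <= val y.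
  have : range r (val y) by rewrite rs; exact: (valP y).
  by move=> [x _ <-]; case/andP: (Hr01 x).
(* Scores are recast as elements of a finite type enumerating the range of r, so that the score
   vector [V] below takes values in a [finType]. *)
pose c j w : seq_sub s := SeqSub (sr j w).
have cU j y : c j @^-1` [set y] = U j @^-1` D (val y).
  by rewrite -DU; apply/seteqP; split => w /= cy; [rewrite -cy|exact/val_inj].
have mc j y : measurable (c j @^-1` [set y]) by rewrite cU -DU.
pose V w := [ffun j => c j w].
have mV k : measurable (V @^-1` [set k]).
  rewrite (_ : _ @^-1` _ = \bigcap_(j in setT) c j @^-1` [set k j]).
    by apply: fin_bigcap_measurable => // j _; exact: mc.
  apply/seteqP; split => [w /= <- j _|w wk]; first by rewrite /= ffunE.
  by apply/ffunP => j; rewrite ffunE; exact: wk.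
pose v (j : 'I_n) (k : {ffun 'I_n -> seq_sub s}) : R := val (k j).
have RsV : Rs = fun j w => v j (V w).
  by apply/funext => j; apply/funext => w; rewrite /v ffunE.
pose q k := condP P V (E a) k - condP P V (E (~~ a)) k.
have qE h : (forall k, 0 <= h k) -> \sum_k q k * h k =
    condE P (fun w => h (V w)) (E a) - condE P (fun w => h (V w)) (E (~~ a)).
  move=> h0; rewrite !condE_finite_range// -sumrB.
  by apply: eq_bigr => k _; rewrite mulrBl.
(* The right-hand side does not mention b: this is where independence enters, and it yields the
   hypothesis [qj]. *)
have condR j b : j != i ->
    condE P (Rs j) (E b) = \sum_y fine (P (c j @^-1` [set y])) * val y.
  move=> ji; rewrite (condE_finite_range P (c j) (mc j) val)//.
  apply: eq_bigr => y _; congr (_ * _); rewrite /condP.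
  rewrite cU EU (iid_pairwise Hiid)// fineM; last 2 first.
  - by rewrite -EU fin_num_measure.
  - by rewrite -DU fin_num_measure.
  rewrite mulrAC divff ?mul1r// gt_eqF// -EU fine_gt0// PE/=.
  by rewrite -ge0_fin_numE// fin_num_measure.
have [||||eps [eps0 Geps]] := @Zeps_average_crossing R n _ v i q.
- by rewrite sumrB !sum_condP// subrr.
- move=> j ji; rewrite qE => [|k]; last exact: r_ge0.
  have -> : (fun w => v j (V w)) = Rs j by rewrite RsV.
  by rewrite !condR// subrr.
- rewrite qE => [|k]; last exact: r_ge0.
  by rewrite subr_gt0; rewrite RsV in Hmean.
- rewrite qE => [|k]; last exact: Zlim_ge0.
  by rewrite subr_lt0; rewrite RsV in Hlim.
exists eps; split => //.
rewrite qE in Geps => [|k]; last exact: Zeps_ge0.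
rewrite /dp_gap RsV.
(* [dp_gap] is the signed average when a is false and its opposite when a is true; both vanish. *)
by case: (a) Geps => //= Geps; rewrite -opprB Geps oppr0.
Qed.
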